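(* For non-negative monotone submodular $f$ under a $k$-uniform matroid constraint (for every positive integer $k$), there exists a deterministic online algorithm with free disposal whose competitive ratio is at least $$\min_{k}\max\left\{\frac1k,\frac1{\alpha_k}\right\}=\frac1{\alpha_4}>0.2959,$$ where the minimum is over positive integers $k$.
   Context: For an integer $k\ge4$, $\alpha_k$ is the unique root in the interval $(3,4)$ of the equation $a=\left(1+\frac{a-2}{k+1}\right)^{k+1}$. For $k\le 3$ the expression $\max\{\frac1k,\frac1{\alpha_k}\}$ is understood to be $\frac1k$. Online problem with free disposal ($k$-uniform matroid): $\Omega$ is a ground set and $f:2^\Omega\to\mathbb{R}_+$ is submodular and monotone ($S\subseteq T$ implies $f(S)\le f(T)$). Distinct elements of $\Omega$ arrive one by one in a finite sequence whose length is unknown to the algorithm. The algorithm maintains a set $S$, initially empty, with $|S|\le k$. In each round, when $u$ arrives, it may remove elements from $S$ and may include $u$ in $S$, provided $|S|\le k$ afterwards; rejected or removed elements cannot be retrieved. $f$ is accessed by a value oracle on sets of arrived elements. $\mathsf{OPT}$ is a subset of at most $k$ elements of the sequence maximizing $f$. A deterministic algorithm has competitive ratio (at least) $r$ if at the end of every finite sequence, $f(S)\ge r\cdot f(\mathsf{OPT})$. *)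

(* Defs.v *)
From HB Require Import structures.
From mathcomp Require Import all_boot all_order all_algebra.
From mathcomp Require Import finmap.
From mathcomp Require Import boolp classical_sets reals.
From mathcomp Require Import ring lra.

Set Implicit Arguments.
Unset Strict Implicit.
Unset Printing Implicit Defensive.

Import Order.TTheory GRing.Theory Num.Theory.

Local Open Scope ring_scope.

Section Alpha.
Context {R : realType}.
Implicit Types (k : nat) (a : R).

Definition alpha_eq k a : Prop := a = (1 + (a - 2) / k.+1%:R) ^+ k.+1.

Definition alpha_root k : set R := [set a | 3 < a < 4 /\ alpha_eq k a]%classic.

(* For 4 <= k this is the unique element of [alpha_root k], by
   [alpha_root_exists_unique] below; otherwise the value is irrelevant. *)
Definition alpha k : R := xget 0 (alpha_root k).

(* max {1/k, 1/alpha_k}, read as 1/k when k <= 3. *)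
Definition guarantee k : R :=
  if (k <= 3)%N then k%:R^-1 else Num.max k%:R^-1 (alpha k)^-1.

Definition is_minimum (E : set R) (m : R) : Prop := E m /\ lbound E m.

Lemma tangent_exprn (m : nat) (x y : R) : 0 <= x -> 0 <= y ->
  y ^+ m.+1 + m.+1%:R * y ^+ m * (x - y) <= x ^+ m.+1.
Proof.
move=> x0 y0; elim: m => [|m IH]; first by rewrite !expr1 expr0; lra.
rewrite (exprS x m.+1); apply: le_trans (ler_wpM2l x0 IH).
have ym : 0 <= y ^+ m by rewrite exprn_ge0.
rewrite -subr_ge0.
suff -> : x * (y ^+ m.+1 + m.+1%:R * y ^+ m * (x - y)) -
  (y ^+ m.+2 + m.+2%:R * y ^+ m.+1 * (x - y)) =
  m.+1%:R * y ^+ m * (x - y) ^+ 2.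
  by rewrite mulr_ge0 ?sqr_ge0// mulr_ge0 // ler0n.
rewrite !exprS -[m.+2]addn1 natrD expr0; ring.
Qed.

Lemma exprn_1D_lt (x : R) (j : nat) : 0 < x -> j.+1%:R * x <= 1 ->
  (1 + x) ^+ j.+2 < 1 + j.+2%:R * x + (j.+2%:R * x) ^+ 2.
Proof.
move=> x0; elim: j => [|j IH] jx.
  by rewrite !expr2; nra.
have jx' : j.+1%:R * x <= 1.
  by apply: le_trans jx; rewrite ler_wpM2r ?ler_nat// ltW.
rewrite exprSr; have x1 : 0 < 1 + x by lra.
have := IH jx'; rewrite -(ltr_pM2r x1) => /lt_le_trans; apply.
have -> : j.+3%:R * x = j.+2%:R * x + x by rewrite -[j.+3]addn1 natrD mulrDl mul1r.
have t0 : 0 <= j.+2%:R * x by rewrite mulr_ge0 ?ler0n// ltW.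
move: jx t0; set t := j.+2%:R * x => t1 t0.
rewrite -subr_ge0.
have -> : 1 + (t + x) + (t + x) ^+ 2 - (1 + t + t ^+ 2) * (1 + x) =
  x * (x + t * (1 - t)) by rewrite !expr2; ring.
apply: mulr_ge0; first exact: ltW.
by apply: addr_ge0; [exact: ltW | apply: mulr_ge0; rewrite ?subr_ge0].
Qed.

Lemma exprn_1D_ge (x : R) (j : nat) : 0 <= x ->
  1 + j%:R * x + j%:R * (j%:R - 1) / 2 * x ^+ 2 <= (1 + x) ^+ j.
Proof.
move=> x0; elim: j => [|j IH]; first by rewrite expr0; lra.
have x1 : 0 <= 1 + x by lra.
rewrite (exprSr (1 + x)); apply: le_trans (ler_wpM2r x1 IH).
rewrite -addn1 natrD -subr_ge0.
have -> : (1 + j%:R * x + j%:R * (j%:R - 1) / 2 * x ^+ 2) * (1 + x) -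
  (1 + (j%:R + 1%:R) * x + (j%:R + 1%:R) * (j%:R + 1%:R - 1) / 2 * x ^+ 2) =
  (j%:R * (j%:R - 1)) * (x ^+ 3 / 2) :> R by field.
apply: mulr_ge0; last by rewrite divr_ge0 ?exprn_ge0.
case: j {IH} => [|j]; first by rewrite mul0r.
by rewrite mulr_ge0 ?ler0n// subr_ge0 ler1n.
Qed.

Lemma alpha_root_exists_unique k : (4 <= k)%N -> exists! a, alpha_root k a.
Proof.
move=> k4; pose n : R := k.+1%:R.
have n5 : 5 <= n by rewrite /n (ler_nat _ 5).
have n0 : 0 < n by lra.
pose h (a : R) := (1 + (a - 2) / n) ^+ k.+1.
have h3 : h 3 < 3.
  rewrite /h; have -> : (3 - 2 : R) = 1 by lra.
  case: k k4 @n n5 n0 @h => // k k4 n n5 n0 h.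
  have nV : n * (1 / n) = 1 by field; lra.
  have := @exprn_1D_lt (1 / n) k; rewrite divr_gt0 // -/n nV expr1n.
  have -> : (1 + 1 + 1 : R) = 3 by lra.
  apply=> //; rewrite -[leRHS]nV ler_wpM2r ?divr_ge0 ?ler_nat //; lra.
have h4 : 4 < h 4.
  have x0 : 0 <= (4 - 2) / n by apply: divr_ge0; lra.
  apply: lt_le_trans (exprn_1D_ge k.+1 x0); rewrite -/n -subr_gt0.
  have -> : 1 + n * ((4 - 2) / n) + n * (n - 1) / 2 * ((4 - 2) / n) ^+ 2 - 4 =
    (n - 2) / n by field; lra.
  by apply: divr_gt0; lra.
have tg a b : 3 <= a -> 3 <= b ->
    h b + (n * (1 + (b - 2) / n) ^+ k / n) * (a - b) <= h a.
  move=> a3 b3.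
  have p (c : R) : 3 <= c -> 0 <= 1 + (c - 2) / n.
    by move=> c3; rewrite addr_ge0 ?ler01// divr_ge0 //; lra.
  have := tangent_exprn k (p _ a3) (p _ b3); rewrite -/n -/(h a) -/(h b).
  congr (_ + _ <= _); field; lra.
have lt_root a b : 3 < a -> a < b -> h a = a -> h b = b -> False.
  move=> a3 ab ha hb.
  have := @tg 3 a; have := @tg b a; rewrite ha hb.
  set s := n * _ / n => t1 t2.
  have {t1} t1 : a + s * (b - a) <= b by apply: t1; lra.
  have {t2} t2 : a + s * (3 - a) <= h 3 by apply: t2; lra.
  have : s <= 1 by rewrite -(ler_pM2r (x := b - a)); lra.
  have : 1 < s by rewrite -(ltr_pM2r (x := a - 3)); lra.
  lra.
pose p : {poly R} := (1 + (n^-1)%:P * ('X - 2%:P)) ^+ k.+1 - 'X.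
have pE a : p.[a] = h a - a.
  by rewrite /p !hornerE /= /h; congr (_ ^+ _ - _); rewrite mulrC.
have [||a /andP[a3 a4] ] := @poly_ivt R p 3 4; first lra.
  by rewrite !pE; apply/andP; split; lra.
rewrite rootE pE subr_eq0 => /eqP ha.
have {}a3 : 3 < a by rewrite lt_neqAle a3 andbT; apply/eqP => e; rewrite -e in ha; lra.
have {}a4 : a < 4 by rewrite lt_neqAle a4 andbT; apply/eqP => e; rewrite e in ha; lra.
exists a; split; first by split; [rewrite a3 a4|rewrite /alpha_eq -/n -/(h a)].
move=> b [/andP[b3 b4]]; rewrite /alpha_eq -/n -/(h b) => /esym hb.
have [ab|ba|//] := ltgtP a b; first by case: (lt_root a b).
by case: (lt_root b a).
Qed.

End Alpha.
Arguments alpha : clear implicits.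
Arguments guarantee : clear implicits.

(* Only finite subsets of the (arbitrary) ground set [T] ever occur, so set
   functions are taken on finite sets; for finite [T] this is all of 2^T. *)
Section SetFunctions.
Context {R : realType} {T : choiceType}.
Implicit Types f : {fset T} -> R.

Definition nonnegative f : Prop := forall A, 0 <= f A.

Definition monotone f : Prop :=
  forall A B, (A `<=` B)%fset -> f A <= f B.

Definition submodular f : Prop :=
  forall A B, f (A `|` B)%fset + f (A `&` B)%fset <= f A + f B.

End SetFunctions.

(* The algorithm does not know the ground set in advance: it refers to an element
   by its arrival time (0, 1, ...).  In round [n], it is given a value oracle for
   the sets of elements arrived so far, the new one included, and answers with
   the elements it removes and whether it includes the new element.  All
   earlier oracle answers, hence all earlier decisions and the current set, are
   determined by the present oracle, so they need not be passed along. *)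
Definition online_algorithm (R : realType) : Type :=
  nat -> ({fset nat} -> R) -> {fset nat} * bool.

Section Run.
Context {R : realType} {T : choiceType}.
Implicit Types (f : {fset T} -> R) (s : seq T) (I : {fset nat}).

(* The elements of the sequence [s] whose arrival times belong to [I]; times
   beyond the end of [s] denote nothing. *)
Definition arrived s I : {fset T} :=
  [fset x in s | index x s \in I]%fset.

Definition oracle f s : {fset nat} -> R := fun I => f (arrived s I).

(* The set S after the first [n] elements of [s] have been processed. *)
Fixpoint maintained (alg : online_algorithm R) f s (n : nat) : {fset T} :=
  if n is m.+1 then
    let seen := take n s in
    let d := alg m (oracle f seen) in
    let kept := (maintained alg f s m `\` arrived seen d.1)%fset in
    if d.2 then (kept `|` arrived seen [fset m])%fset else kept
  else fset0.

Definition optimal (k : nat) f s (O : {fset T}) : Prop :=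
  [/\ {subset O <= s}, (#|` O| <= k)%N &
      forall O' : {fset T}, {subset O' <= s} -> (#|` O'| <= k)%N -> f O' <= f O].

End Run.

Definition feasible (R : realType) (k : nat) (alg : online_algorithm R) : Prop :=
  forall (T : choiceType) (f : {fset T} -> R),
    nonnegative f -> monotone f -> submodular f ->
  forall s : seq T, uniq s ->
  forall n, (n <= size s)%N -> (#|` maintained alg f s n| <= k)%N.

Definition competitive (R : realType) (k : nat) (alg : online_algorithm R)
    (r : R) : Prop :=
  forall (T : choiceType) (f : {fset T} -> R),
    nonnegative f -> monotone f -> submodular f ->
  forall s : seq T, uniq s ->
  forall OPT : {fset T}, optimal k f s OPT ->
    r * f OPT <= f (maintained alg f s (size s)).

(* Main.v *)
Require Import Defs.
From HB Require Import structures.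
From mathcomp Require Import all_boot all_order all_algebra.
From mathcomp Require Import finmap.
From mathcomp Require Import boolp classical_sets reals.
From mathcomp Require Import ring lra.
Import Order.TTheory GRing.Theory Num.Theory.
Local Open Scope fset_scope.
Local Open Scope ring_scope.

Set Implicit Arguments.
Unset Strict Implicit.
Unset Printing Implicit Defensive.

(* For k <= 3, keeping the best singleton is 1/k-competitive and 1/alpha_4 < 1/3.

   For k >= 4 put a = alpha_k and q = 1 + (a - 2) / (k + 1), so q ^ (k + 1) = a.
   Let A be the set of all elements accepted so far and give each of them as
   weight its marginal value over A when it was accepted; by submodularity
   f(S) >= W := f(0) + (sum of the weights of S).  The slack is a W - f(A), and a
   new element of marginal value w over A is accepted when k w >= slack, evicting
   the lightest element if S is full.  If b_1, b_2, ... are the weights of S,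
   most recent first, then q b_1 + q ^ 2 b_2 + ... <= slack is invariant.  It
   implies that the slack never decreases, so that every rejected element has
   marginal value at most slack / k over the final A, whence
   f(OPT) <= f(A) + slack = a W <= a f(S). *)

(** * Estimates on the roots alpha_k *)

Section AlphaBounds.
Context {R : realType}.
Implicit Types (k : nat) (a y : R).

Lemma alphaP k : (4 <= k)%N -> alpha_root k (alpha R k).
Proof.
by move=> /(@alpha_root_exists_unique R)[a [ha _]]; apply: (xgetPex 0); exists a.
Qed.

(** At [x = 1 / n] with [n = k + 1], the bound [1 + n x + (n x) ^ 2] on [(1 + x) ^ n] equals 1 + 1 +
    1. *)
Lemma alpha_map3_lt k : (4 <= k)%N ->
  (1 + (3 - 2) / k.+1%:R) ^+ k.+1 < 3 :> R.
Proof.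
case: k => // k k4; have n0 : 0 < k.+2%:R :> R by rewrite ltr0n.
have nV : k.+2%:R * (1 / k.+2%:R) = 1 :> R by rewrite div1r mulfV ?gt_eqF.
have -> : 3 - 2 = 1 :> R by lra.
have := @exprn_1D_lt R (1 / k.+2%:R) k.
rewrite divr_gt0 // nV expr1n (_ : 1 + 1 + 1 = 3 :> R); last by lra.
by apply=> //; rewrite -[leRHS]nV ler_wpM2r ?divr_ge0 ?ler_nat.
Qed.

(* Convexity of [a |-> (1 + (a - 2) / (k + 1)) ^ (k + 1)], which is below the
   identity at 3 and has [alpha k] as a fixed point. *)
Lemma alpha_le k y : (4 <= k)%N -> 3 < y ->
  y <= (1 + (y - 2) / k.+1%:R) ^+ k.+1 -> alpha R k <= y.
Proof.
move=> k4 y3 hy; rewrite leNgt; apply/negP => ya.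
have [/andP[a3 a4] ha] := alphaP k4.
have n0 : 0 < k.+1%:R :> R by rewrite ltr0n.
have p (c : R) : 3 <= c -> 0 <= 1 + (c - 2) / k.+1%:R.
  by move=> c3; rewrite addr_ge0 ?ler01// divr_ge0 //; lra.
have tg (a : R) : 3 <= a -> y + (1 + (y - 2) / k.+1%:R) ^+ k * (a - y) <=
    (1 + (a - 2) / k.+1%:R) ^+ k.+1.
  move=> age; have := tangent_exprn k (p _ age) (p _ (ltW y3)).
  apply: le_trans; rewrite -mulrA [k.+1%:R * _]mulrC -mulrA.
  rewrite (_ : _ * k.+1%:R = a - y) ?lerD2r //.
  have e (c : R) : (c / k.+1%:R) * k.+1%:R = c by rewrite divfK ?gt_eqF.
  by rewrite mulrBl !(mulrDl 1) !e; lra.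
have t3 := tg 3 (lexx _); have := tg (alpha R k); rewrite -ha => /(_ (ltW a3)) ta.
have := alpha_map3_lt k4; move: t3 ta; set s := _ ^+ k; set h3 := _ ^+ k.+1.
move=> t3 ta h3lt.
(* [s] is the slope at [y]. If [y < alpha R k], the tangent estimate at the fixed point forces
   [s <= 1], and at 3 it forces [s > 1]. *)
have s1 : s <= 1 by rewrite -(ler_pM2r (x := alpha R k - y)); lra.
have : 1 < s by rewrite -(ltr_pM2r (x := y - 3)); lra.
lra.
Qed.

(** The tangent to [x ^ (n + 1)] at [1 + t / n], evaluated at [1 + t / (n + 1)], takes exactly the
    value [(1 + t / n) ^ n]. *)
Lemma expr_1Ddiv_homo (n : nat) (t : R) : (0 < n)%N -> 0 <= t ->
  (1 + t / n%:R) ^+ n <= (1 + t / n.+1%:R) ^+ n.+1.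
Proof.
move=> n0 t0; have p m : 0 <= 1 + t / m%:R by rewrite addr_ge0 ?ler01// divr_ge0.
have := tangent_exprn n (p n.+1) (p n).
have -> // : (1 + t / n%:R) ^+ n.+1 + n.+1%:R * (1 + t / n%:R) ^+ n *
  (1 + t / n.+1%:R - (1 + t / n%:R)) = (1 + t / n%:R) ^+ n.
have nn0 : n%:R != 0 :> R by rewrite pnatr_eq0 -lt0n.
have n1 : n%:R + 1 != 0 :> R by rewrite natr1 pnatr_eq0.
by rewrite exprS -natr1; field; rewrite nn0 n1.
Qed.

Lemma alpha_le4 k : (4 <= k)%N -> alpha R k <= alpha R 4.
Proof.
elim: k => // k IH; rewrite leq_eqVlt => /orP[/eqP <- //|k4].
apply: le_trans (IH k4); have [/andP[a3 _] ha] := alphaP k4.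
apply: alpha_le => //; first exact: ltnW.
by rewrite {1}ha; apply: expr_1Ddiv_homo => //; lra.
Qed.

Lemma alpha4_lt : alpha R 4 < 10000 / 2959.
Proof.
(* 3.379 is just below 10000 / 2959 = 3.3795..., and [alpha_le] applies to it because 1 + 1.379 / 5
   = 1.2758 and 1.2758 ^ 5 = 3.3799... *)
apply: (@le_lt_trans _ _ (3379 / 1000)); last by lra.
by apply: alpha_le => //; lra.
Qed.

Lemma guarantee_min :
  is_minimum [set guarantee R k | k in [set k : nat | (0 < k)%N]]%classic
    (alpha R 4)^-1.
Proof.
have [/andP[a3 a4] _] := alphaP (leqnn 4).
have a0 : 0 < alpha R 4 by lra.
split.
  exists 4%N => //; rewrite /guarantee /=; apply/max_idPr.
  by rewrite lef_pV2 ?posrE //; lra.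
move=> _ [k /= k0 <-]; rewrite /guarantee; case: leqP => k3.
  have : k%:R <= 3 :> R by rewrite (ler_nat _ k 3).
  by move=> ?; rewrite lef_pV2 ?posrE ?ltr0n //; lra.
have [/andP[b3 _] _] := alphaP k3.
rewrite le_max; apply/orP; right.
by rewrite lef_pV2 ?posrE ?alpha_le4 //; lra.
Qed.

End AlphaBounds.

(** * Diminishing returns *)

Section Submodular.
Context {R : realType} {T : choiceType}.
Variable g : {fset T} -> R.
Hypotheses (g_mono : monotone g) (g_sub : submodular g).

Lemma marginal_ge0 x A : 0 <= g (x |` A) - g A.
Proof. by rewrite subr_ge0 g_mono ?fsubsetU1. Qed.

Lemma marginal_antitone x (A B : {fset T}) : A `<=` B ->
  g (x |` B) - g B <= g (x |` A) - g A.
Proof.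
move=> AB; have := g_sub (x |` A) B.
rewrite -fsetUA (fsetUidPr _ _ AB) => sub.
have : g A <= g ((x |` A) `&` B).
  by apply: g_mono; rewrite fsubsetI AB fsubsetU1.
lra.
Qed.

Lemma submodular_seq_bound (A : {fset T}) (s : seq T) :
  g (A `|` [fset x in s]) <= g A + \sum_(x <- s) (g (x |` A) - g A).
Proof.
elim: s => [|x s IH].
  by rewrite big_nil addr0 (_ : [fset x in [::]] = fset0) ?fsetU0 //; apply/fsetP => x; rewrite !inE.
rewrite big_cons fset_cons fsetUCA.
have := @marginal_antitone x A (A `|` [fset x in s]) (fsubsetUl _ _).
lra.
Qed.

Lemma submodular_bound (A O : {fset T}) (c : R) :
  (forall x, x \in O -> g (x |` A) - g A <= c) ->
  g O <= g A + c *+ #|` O|.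
Proof.
move=> hc; apply: (@le_trans _ _ (g (A `|` O))).
  by rewrite g_mono // fsubsetUr.
have := submodular_seq_bound A (enum_fset O); set X := [fset x | x in _].
have -> : X = O by apply/fsetP => x; rewrite /X !inE.
move=> /le_trans; apply; rewrite lerD2l.
rewrite -sum1_size -sumrMnr; rewrite big_seq [leRHS]big_seq.
by apply: ler_sum => x xO; rewrite mulr1n hc.
Qed.

End Submodular.

(** * Online algorithms from selection rules on arrival times *)

Section Selection.
Context {R : realType}.

Definition iota_fset (n : nat) : {fset nat} := [fset i in iota 0 n].

Lemma in_iota_fset n i : (i \in iota_fset n) = (i < n)%N.
Proof. by rewrite !inE mem_iota. Qed.

Definition agree (n : nat) (g g' : {fset nat} -> R) : Prop :=
  forall I, I `<=` iota_fset n -> g I = g' I.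

(** This is the online requirement: decisions after [n] rounds use only oracle answers on the first
    [n] arrivals. It allows the oracle of the whole sequence to replace the truncated ones. *)
Definition local (X : Type) (D : nat -> ({fset nat} -> R) -> X) : Prop :=
  forall n g g', agree n g g' -> D n g = D n g'.

(* [D n g] is the set of arrival times kept after [n] rounds. *)
Definition selection_algorithm (D : nat -> ({fset nat} -> R) -> {fset nat}) :
    online_algorithm R :=
  fun m g => (iota_fset m `\` D m.+1 g, m \in D m.+1 g).

Section Arrived.
Context {T : choiceType}.
Implicit Types (s : seq T) (I J : {fset nat}).

Lemma in_arrived s I x : (x \in arrived s I) = (x \in s) && (index x s \in I).
Proof. by rewrite !inE. Qed.

Lemma arrivedU s I J : arrived s (I `|` J) = arrived s I `|` arrived s J.
Proof. by apply/fsetP => x; rewrite !(in_arrived, in_fsetE) andb_orr. Qed.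

Lemma arrivedI s I J : arrived s (I `&` J) = arrived s I `&` arrived s J.
Proof. by apply/fsetP => x; rewrite !(in_arrived, in_fsetE) andbACA andbb. Qed.

Lemma arrivedD s I J : arrived s (I `\` J) = arrived s I `\` arrived s J.
Proof.
by apply/fsetP => x; rewrite !(in_arrived, in_fsetE); case: (x \in s).
Qed.

Lemma arrivedS s I J : I `<=` J -> arrived s I `<=` arrived s J.
Proof.
move=> /fsubsetP IJ; apply/fsubsetP => x; rewrite !in_arrived.
by case/andP => -> /IJ.
Qed.

Lemma arrived_take s n I : I `<=` iota_fset n ->
  arrived (take n s) I = arrived s I.
Proof.
move=> /fsubsetP In; apply/fsetP => x; rewrite !in_arrived.
have [xn|xn] := boolP (x \in take n s).
  by rewrite (mem_take xn) -[in RHS](cat_take_drop n s) index_cat xn.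
apply/esym/negbTE/negP => /andP[xs /In].
by rewrite in_iota_fset -(in_take _ xs) (negbTE xn).
Qed.

Lemma card_arrived s I : (#|` arrived s I| <= #|` I|)%N.
Proof.
have <- : #|` [fset index x s | x in arrived s I]| = #|` arrived s I|.
  apply: card_in_imfset => x y; rewrite !in_arrived => /andP[xs _] /andP[ys _].
  by move=> /(congr1 (nth x s)); rewrite !nth_index.
apply: fsubset_leq_card; apply/fsubsetP => _ /imfsetP[x /= + ->].
by rewrite in_arrived => /andP[].
Qed.

(** Pulls the optimum back to a set of times, where the bounds on selection rules apply. *)
Lemma arrived_index s (O : {fset T}) : {subset O <= s} ->
  arrived s [fset index x s | x in O] = O.
Proof.
move=> Os; apply/fsetP => x; rewrite in_arrived.
apply/andP/idP => [[xs /imfsetP[y /= yO]]|xO].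
  by move=> /(congr1 (nth x s)); rewrite !nth_index ?(Os _ yO) // => ->.
by split; [exact: Os | apply/imfsetP; exists x].
Qed.

End Arrived.

Variable D : nat -> ({fset nat} -> R) -> {fset nat}.
Hypotheses (D0 : forall g, D 0 g = fset0)
  (DS : forall n g, D n.+1 g `<=` n |` D n g) (Dlocal : local D).

Lemma selection_sub n g : D n g `<=` iota_fset n.
Proof.
elim: n => [|n IH]; first by rewrite D0.
apply/fsubsetP => i /(fsubsetP (DS n g)); rewrite in_fset1U.
by case/orP => [/eqP ->|/(fsubsetP IH)]; rewrite !in_iota_fset // => /leqW.
Qed.

(** By [DS] a dropped time never returns, so deleting the earlier times outside [D n.+1] and adding
    [n] when it is selected turns [D n] into exactly [D n.+1]. *)
Lemma maintained_selection (T : choiceType) (f : {fset T} -> R) (s : seq T) n :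
  (n <= size s)%N ->
  maintained (selection_algorithm D) f s n = arrived s (D n (oracle f s)).
Proof.
elim: n => [_|n IH ns] /=; first by rewrite D0; apply/fsetP => x; rewrite in_arrived andbF.
rewrite IH ?(ltnW ns) //=.
have -> : D n.+1 (oracle f (take n.+1 s)) = D n.+1 (oracle f s).
  by apply: Dlocal => I In; rewrite /oracle arrived_take.
set g := oracle f s; have subn : [fset n] `<=` iota_fset n.+1.
  by rewrite fsub1set in_iota_fset.
rewrite !arrived_take //; last first.
  by apply/fsubsetP => i; rewrite in_fsetD !in_iota_fset => /andP[_ /leqW].
rewrite -arrivedD -arrivedU -fun_if; congr arrived; apply/fsetP => i.
rewrite (_ : (if _ then _ else _) = (D n g `\` (iota_fset n `\` D n.+1 g)) `|`
  (if n \in D n.+1 g then [fset n] else fset0)); last first.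
  by case: ifP; rewrite ?fsetU0.
have := fsubsetP (DS n g) i; have := fsubsetP (selection_sub n g) i.
rewrite in_fset1U in_fsetU 2!in_fsetD in_iota_fset.
have [-> + _|ne + /=] := eqVneq i n.
  rewrite ltnn; case: (n \in D n g) => [/(_ isT) //|_].
  by case: ifP => nD; rewrite ?in_fset1 ?eqxx ?in_fset0 // andbF.
rewrite (_ : (i \in (if _ then _ else _)) = false) ?orbF; last first.
  by case: ifP; rewrite ?in_fset1 // (negbTE ne).
case: (i \in D n g) => [/(_ isT) ->|_]; first by rewrite !andbT negbK.
by rewrite andbF; case: (i \in D n.+1 g) => // /(_ isT).
Qed.

(** [arrived s] preserves unions, intersections and inclusions, so [oracle f s] inherits all
    hypotheses on [f]; it suffices to study set functions on times. *)
Lemma selection_competitive (k : nat) (r : R) :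
  (forall n g, (#|` D n g| <= k)%N) ->
  (forall n g, nonnegative g -> monotone g -> submodular g ->
     forall O, O `<=` iota_fset n -> (#|` O| <= k)%N -> r * g O <= g (D n g)) ->
  feasible k (selection_algorithm D) /\ competitive k (selection_algorithm D) r.
Proof.
move=> Dk Dr; split=> T f f0 fm fs s us.
  by move=> n ns; rewrite maintained_selection // (leq_trans (card_arrived _ _)).
move=> O [Os Ok _]; rewrite maintained_selection //.
rewrite -[in leLHS](arrived_index Os) -/(oracle f s _); apply: Dr.
- by move=> I; exact: f0.
- by move=> I J IJ; apply/fm/arrivedS.
- by move=> I J; rewrite /oracle arrivedU arrivedI; exact: fs.
- apply/fsubsetP => _ /imfsetP[x /= xO ->].
  by rewrite in_iota_fset index_mem Os.
- by rewrite (leq_trans _ Ok) // leq_imfset_card.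
Qed.

End Selection.

(** * Geometrically weighted sums *)

Section GeometricSum.
Context {R : realType}.
Variable q : R.
Hypothesis q1 : 1 < q.
Implicit Types (l : seq (nat * R)) (p : nat * R).

(** Horner form of [q b_1 + q ^ 2 b_2 + ...], where [b_1] is the weight at the head. *)
Definition geom_sum l : R := foldr (fun p acc => q * (p.2 + acc)) 0 l.

(** Replace every weight by [m] and sum the geometric series; the factor [q - 1] avoids a
    division. *)
Lemma geom_sum_ge m l : (forall p, p \in l -> m <= p.2) ->
  m * (q ^+ (size l).+1 - q) <= (q - 1) * geom_sum l.
Proof.
have gt1q := q1.
elim: l => [|p l IH] hm /=; first by rewrite expr1 subrr !mulr0.
have {}IH : m * (q ^+ (size l).+1 - q) <= (q - 1) * geom_sum l.
  by apply: IH => r rl; rewrite hm // inE rl orbT.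
have := hm p (mem_head _ _); move: IH; rewrite (exprS q (size l).+1).
set t := q ^+ _; set F := geom_sum l => IH mp.
have -> : m * (q * t - q) = q * (m * (t - q) + (q - 1) * m) by ring.
have -> : (q - 1) * (q * (p.2 + F)) = q * ((q - 1) * F + (q - 1) * p.2) by ring.
by rewrite ler_pM2l ?lerD ?ler_pM2l //; lra.
Qed.

(** Removing position [i] loses [q ^ i p.2], and each later weight, being at least [p.2], loses at
    least [(q ^ j - q ^ (j - 1)) p.2]. These losses telescope to [q ^ size l * p.2]. *)
Lemma geom_sum_rem p l : p \in l -> (forall r, r \in l -> p.2 <= r.2) ->
  geom_sum (rem p l) + q ^+ size l * p.2 <= geom_sum l.
Proof.
have gt1q := q1.
elim: l => // r l IH; rewrite inE /= => pl hp.
have hl s : s \in l -> p.2 <= s.2 by move=> sl; rewrite hp // inE sl orbT.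
have [->|rp] := eqVneq r p.
  by have := geom_sum_ge hl; rewrite exprS; lra.
have {}pl : p \in l by move: pl; rewrite eq_sym (negbTE rp).
have := IH pl hl; rewrite exprS /=.
set t := q ^+ _; set F := geom_sum l; set F' := geom_sum _ => h.
rewrite -mulrA -mulrDr ler_pM2l; lra.
Qed.

End GeometricSum.

(** * Eviction of a lightest element *)

Section Lightest.
Context {R : realType}.
Implicit Types (l : seq (nat * R)) (p : nat * R).

Fixpoint lightest p l : nat * R :=
  if l is r :: l' then lightest (if p.2 <= r.2 then p else r) l' else p.

Definition evict l : seq (nat * R) :=
  if l is p :: l' then rem (lightest p l') l else [::].

Lemma lightestP p l : lightest p l \in p :: l /\
  forall r, r \in p :: l -> (lightest p l).2 <= r.2.
Proof.
elim: l p => [|r l IH] p /=.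
  by split=> [|r]; rewrite ?mem_head // inE => /eqP ->.
case: leP => pr; have [h1 h2] := IH (if p.2 <= r.2 then p else r).
  rewrite pr in h1 h2; split=> [|s].
    by move: h1; rewrite !inE; case/orP => ->; rewrite ?orbT.
  rewrite !inE => /or3P[/eqP ->|/eqP ->|sl].
  - exact/h2/mem_head.
  - exact: le_trans (h2 _ (mem_head _ _)) pr.
  - by rewrite h2 // inE sl orbT.
rewrite leNgt pr /= in h1 h2; split=> [|s]; first by rewrite inE h1 orbT.
rewrite !inE => /or3P[/eqP ->|/eqP ->|sl].
- exact: le_trans (h2 _ (mem_head _ _)) (ltW pr).
- exact/h2/mem_head.
- by rewrite h2 // inE sl orbT.
Qed.

Lemma evictP l : (0 < size l)%N -> exists p,
  [/\ p \in l, forall r, r \in l -> p.2 <= r.2 & evict l = rem p l].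
Proof.
case: l => // p l _; exists (lightest p l).
by have [? ?] := lightestP p l.
Qed.

End Lightest.

(** * The threshold algorithm and its invariant *)

Section Threshold.
Context {R : realType}.
Variables (k : nat) (a q : R).
Hypotheses (k0 : (0 < k)%N) (q1 : 1 < q) (aX : q ^+ k.+1 = a)
  (aE : a = 2 + k.+1%:R * (q - 1)).

(* A state consists of the set of all elements accepted so far, and of the
   elements currently kept, the most recent first, each one paired with its
   marginal value at the time of its acceptance. *)
Notation state := ({fset nat} * seq (nat * R))%type.
Implicit Types (st : state) (g : {fset nat} -> R) (l : seq (nat * R)).

Definition value g l : R := g fset0 + \sum_(p <- l) p.2.

Definition slack g st : R := a * value g st.2 - g st.1.

Definition threshold_step n g st : state :=
  let w := g (n |` st.1) - g st.1 in
  if slack g st <= k%:R * w then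
    (n |` st.1, (n, w) :: (if (size st.2 < k)%N then st.2 else evict st.2))
  else st.

Fixpoint threshold_state n g : state :=
  if n is m.+1 then threshold_step m g (threshold_state m g)
  else (fset0, [::]).

Definition threshold_selection n g : {fset nat} :=
  [fset i in unzip1 (threshold_state n g).2].

Lemma accepted_sub n g : (threshold_state n g).1 `<=` iota_fset n.
Proof.
elim: n => [|n IH] /=; first by rewrite fsub0set.
have {}IH : (threshold_state n g).1 `<=` iota_fset n.+1.
  apply: fsubset_trans IH _; apply/fsubsetP => i; rewrite !in_iota_fset.
  exact: leqW.
rewrite /threshold_step; case: ifP => //= _.
by rewrite fsubUset IH fsub1set in_iota_fset ltnSn.
Qed.

Lemma threshold_state_local : local threshold_state.
Proof.
elim=> // n IH g g' e /=.
have e' I : I `<=` iota_fset n -> g I = g' I.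
  move=> In; apply: e; apply: fsubset_trans In _; apply/fsubsetP => i.
  by rewrite !in_iota_fset; exact: leqW.
rewrite -(IH _ _ e') /threshold_step /slack /value.
have sub := accepted_sub n g.
rewrite -(e' fset0) ?fsub0set // -(e' _ sub) -(e (n |` _)) //.
rewrite fsubUset fsub1set in_iota_fset ltnSn /=.
apply: fsubset_trans sub _; apply/fsubsetP => i.
by rewrite !in_iota_fset; exact: leqW.
Qed.

Lemma threshold_selectionS n g :
  threshold_selection n.+1 g `<=` n |` threshold_selection n g.
Proof.
apply/fsubsetP => i; rewrite /threshold_selection /= /threshold_step.
set st := threshold_state n g; case: ifP => _; last by rewrite !inE => ->; rewrite orbT.
rewrite /= !inE; case/orP => [->//|]; case: ifP => _; first by move=> ->; rewrite orbT.
case: (posnP (size st.2)) => [/size0nil -> //|/evictP[p [_ _ ->]]].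
by case/mapP => r /mem_rem rl ->; rewrite map_f ?orbT.
Qed.

Lemma size_threshold_state n g : (size (threshold_state n g).2 <= k)%N.
Proof.
elim: n => //= n IH; rewrite /threshold_step; case: ifP => //= _.
case: (ltnP (size (threshold_state n g).2) k) => // ks.
have [|p [pl _ ->]] := @evictP R (threshold_state n g).2; first exact: leq_trans ks.
by rewrite size_rem // prednK ?(leq_trans k0 ks).
Qed.

Lemma card_threshold_selection n g : (#|` threshold_selection n g| <= k)%N.
Proof.
rewrite card_fseq (leq_trans (size_undup _)) // size_map.
exact: size_threshold_state.
Qed.

(** Here [S] is the slack, [F] and [F'] are the geometric sums before and after evicting weight [m],
    and [w] is the accepted weight. Then [q F' <= q S - a m], the excess [(q - 1) S] is at most
    [(q - 1) k w], and [q + k (q - 1) = a - 1]. *)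
Lemma accept_geom_sum (S F F' w m : R) : F <= S -> S <= k%:R * w ->
  F' + q ^+ k * m <= F -> q * (w + F') <= S + (a - 1) * w - a * m.
Proof.
have gt1q := q1.
move=> FS Sw F'F.
have h : (q - 1) * S <= (q - 1) * (k%:R * w) by rewrite ler_wpM2l; lra.
have : q * (F' + q ^+ k * m) <= q * S by rewrite ler_wpM2l; lra.
rewrite mulrDr mulrA -exprS aX.
have -> : (a - 1) * w = q * w + (q - 1) * (k%:R * w).
  by rewrite aE -natr1; ring.
by lra.
Qed.

(** Acceptance changes the slack by [(a - 1) w - a m]. With [x = q - 1] and [y = k x], the
    hypotheses give [m (1 + y) <= y w], and the claim follows from [(1 + y + x) (1 + y) - y (2 + y +
    x) = 1 + x >= 0]. *)
Lemma accept_slack (S w m : R) : S <= k%:R * w -> 0 <= m ->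
  m * (a - q) <= (q - 1) * S -> a * m <= (a - 1) * w.
Proof.
have gt1q := q1.
move=> Sw m0 mS; have kR : 0 < k%:R :> R by rewrite ltr0n.
have x0 : 0 < q - 1 by lra.
have kx : 0 < k%:R * (q - 1) by rewrite mulr_gt0.
have aq : a - q = 1 + k%:R * (q - 1) by rewrite aE -natr1; ring.
have a1 : a - 1 = 1 + k%:R * (q - 1) + (q - 1) by rewrite aE -natr1; ring.
rewrite -(ler_pM2l kx).
apply: (@le_trans _ _ ((a - 1) * (m * (a - q)))).
  rewrite aq a1 (_ : a = 2 + k%:R * (q - 1) + (q - 1)); last first.
    by rewrite aE -natr1; ring.
  set y := k%:R * (q - 1) in kx *; set x := q - 1 in x0 *.
  rewrite -subr_ge0.
  have -> : (1 + y + x) * (m * (1 + y)) - y * ((2 + y + x) * m) =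
    m * (1 + x) by ring.
  by apply: mulr_ge0; lra.
rewrite (_ : _ * _ * _ = (a - 1) * ((q - 1) * (k%:R * w))); last by ring.
rewrite ler_pM2l; last by lra.
by apply: le_trans mS _; rewrite ler_pM2l.
Qed.

(** [inv_value] ranges over all subsequences so that it survives the eviction of an arbitrary entry.
    [inv_seen] covers accepted times too, as their marginal value is 0. *)
Record threshold_inv n g st : Prop := ThresholdInv {
  inv_kept : {subset unzip1 st.2 <= st.1};
  inv_weight : forall p, p \in st.2 -> 0 <= p.2;
  inv_value : forall l, subseq l st.2 -> value g l <= g [fset i in unzip1 l];
  inv_slack : geom_sum q st.2 <= slack g st;
  inv_seen : forall i, (i < n)%N ->
    k%:R * (g (i |` st.1) - g st.1) <= slack g st }.

Lemma geom_sum_ge0 l : (forall p, p \in l -> 0 <= p.2) -> 0 <= geom_sum q l.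
Proof.
have gt1q := q1.
move=> /(geom_sum_ge q1); rewrite mul0r pmulr_rge0 //; lra.
Qed.

Lemma value_cons g p l : value g (p :: l) = value g l + p.2.
Proof. by rewrite /value big_cons; lra. Qed.

Lemma threshold_invP n g : nonnegative g -> monotone g -> submodular g ->
  threshold_inv n g (threshold_state n g).
Proof.
have gt1q := q1.
move=> g0 gm gs; elim: n => [|n IH] /=.
  split=> //=.
  - by move=> l /eqP ->; rewrite /value big_nil addr0 gm.
  - rewrite /slack /value big_nil addr0 /= subr_ge0 ler_peMl // aE.
    by rewrite -[leLHS]addr0; apply: lerD; [lra | rewrite mulr_ge0 //; lra].
move: IH (size_threshold_state n g); case: (threshold_state n g) => A l /=.
case=> /= kept wt val sl seen szl.
rewrite /threshold_step /=; set w := g (n |` A) - g A.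
case: leP => [acc|rej]; last first.
  split=> // i; rewrite ltnS leq_eqVlt => /orP[/eqP ->|/seen //].
  exact: ltW.
have w0 : 0 <= w by exact: marginal_ge0.
(* The evicted weight [m] is 0 as long as no eviction is needed. *)
set l' := (if _ then _ else _).
have [m [l'l m0 mS F'F vE]] : exists m, [/\ subseq l' l, 0 <= m,
    m * (a - q) <= (q - 1) * slack g (A, l),
    geom_sum q l' + q ^+ k * m <= geom_sum q l &
    value g l = value g l' + m].
  have S0 : 0 <= slack g (A, l) by apply: le_trans sl; exact: geom_sum_ge0.
  rewrite /l'; case: ltnP => [_|ks].
    by exists 0; rewrite mul0r mulr0 !addr0; split=> //; rewrite mulr_ge0 //; lra.
  have sk : size l = k by apply/eqP; rewrite eqn_leq szl.
  have [|p [pl pmin ->]] := @evictP _ l; first by rewrite sk.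
  exists p.2; split; first exact: rem_subseq.
  - exact: wt.
  (* All [k] weights are at least the evicted one, and [q ^ (k + 1) = a]. *)
  - have := geom_sum_ge q1 pmin; rewrite sk aX => /le_trans; apply.
    by rewrite ler_pM2l //; lra.
  - by have := geom_sum_rem q1 pl pmin; rewrite sk.
  - by rewrite /value (perm_big _ (perm_to_rem pl)) /= big_cons; lra.
have slE : slack g (n |` A, (n, w) :: l') = slack g (A, l) + (a - 1) * w - a * m.
  by rewrite /slack /= value_cons vE /= /w; ring.
have inc := accept_slack acc m0 mS.
have slS : slack g (A, l) <= slack g (n |` A, (n, w) :: l') by rewrite slE; lra.
split=> /=.
- move=> i; rewrite inE in_fset1U => /orP[->//|il]; apply/orP; right.
  by apply/kept/(mem_subseq (map_subseq _ l'l)).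
- by move=> p; rewrite inE => /orP[/eqP -> //|/(mem_subseq l'l)]; exact: wt.
- case=> [|p l2]; first by move=> _; apply: val; exact: sub0seq.
  rewrite /=; case: eqP => [->|_] h; last first.
    by apply: val; apply: subseq_trans l'l.
  have {}h : subseq l2 l by apply: subseq_trans l'l.
  rewrite value_cons fset_cons /=.
  (* [w] was measured over [A], so the marginal value of [n] over the smaller set [l2] is at least
     [w]. *)
  have sub : [fset i in unzip1 l2] `<=` A.
    by apply/fsubsetP => i; rewrite inE => /(mem_subseq (map_subseq _ h))/kept.
  have := marginal_antitone gm gs n sub; have := val _ h; rewrite -/w; lra.
- rewrite slE; exact: accept_geom_sum F'F.
(* The slack has not decreased, the new time has marginal value 0, and the marginal values of
   earlier times only shrink as the accepted set grows. *)
- move=> i; rewrite ltnS leq_eqVlt => ilt.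
  apply: le_trans slS; case/orP: ilt => [/eqP ->|/seen].
    rewrite fsetUA fsetUid subrr mulr0; apply: le_trans sl.
    exact: geom_sum_ge0.
  apply: le_trans; rewrite ler_wpM2l //.
  by apply: marginal_antitone => //; exact: fsubsetU1.
Qed.

Lemma threshold_selection_ratio n g O :
  nonnegative g -> monotone g -> submodular g ->
  O `<=` iota_fset n -> (#|` O| <= k)%N ->
  a^-1 * g O <= g (threshold_selection n g).
Proof.
have gt1q := q1.
move=> g0 gm gs On Ok; have [_ wt val sl seen] := threshold_invP n g0 gm gs.
rewrite /threshold_selection; move: wt val sl seen.
case: (threshold_state n g) => A l /= wt val sl seen.
have kR : 0 < k%:R :> R by rewrite ltr0n.
have a0 : 0 < a.
  by rewrite aE; apply: ltr_wpDr; [rewrite mulr_ge0 //; lra | lra].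
have S0 : 0 <= slack g (A, l) by apply: le_trans sl; exact: geom_sum_ge0.
rewrite ler_pdivrMl //; apply: (@le_trans _ _ (a * value g l)); last first.
  by rewrite ler_pM2l // val.
have := @submodular_bound _ _ g gm gs A O (slack g (A, l) / k%:R).
have hO x : x \in O -> g (x |` A) - g A <= slack g (A, l) / k%:R.
  move=> /(fsubsetP On); rewrite in_iota_fset => /seen.
  by rewrite ler_pdivlMr // mulrC.
move=> /(_ hO) /le_trans; apply.
have : slack g (A, l) / k%:R *+ #|` O| <= slack g (A, l).
  rewrite -mulr_natr mulrAC ler_pdivrMr // ler_wpM2l // ler_nat //.
by rewrite {2}/slack /=; lra.
Qed.

End Threshold.

(** * The best singleton, for small k *)

Section BestSingleton.
Context {R : realType}.
Implicit Types (g : {fset nat} -> R).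

Fixpoint best_singleton n g : {fset nat} :=
  if n is m.+1 then
    if g (best_singleton m g) <= g [fset m] then [fset m]
    else best_singleton m g
  else fset0.

Lemma best_singletonS n g : best_singleton n.+1 g `<=` n |` best_singleton n g.
Proof. by rewrite /=; case: ifP => _; rewrite ?fsubsetUl ?fsubsetUr. Qed.

Lemma best_singleton_local : local best_singleton.
Proof.
elim=> // n IH g g' e /=.
have sub : iota_fset n `<=` iota_fset n.+1.
  by apply/fsubsetP => i; rewrite !in_iota_fset; exact: leqW.
have e' I : I `<=` iota_fset n -> g I = g' I.
  by move=> In; apply: e; exact: fsubset_trans sub.
rewrite -(IH _ _ e') -!e ?fsub1set ?in_iota_fset ?ltnSn //.
apply: fsubset_trans sub; apply: selection_sub => //; exact: best_singletonS.
Qed.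

Lemma card_best_singleton n g : (#|` best_singleton n g| <= 1)%N.
Proof. by elim: n => //= n IH; case: ifP; rewrite ?cardfs1. Qed.

Lemma best_singleton_max n g i : (i < n)%N -> g [fset i] <= g (best_singleton n g).
Proof.
elim: n => // n IH; rewrite ltnS leq_eqVlt /=.
case/orP => [/eqP ->|/IH hi]; case: (leP (g (best_singleton n g))) => // h; first exact: ltW.
exact: le_trans hi h.
Qed.

(** Marginal values over the empty set are at most [M - g fset0], so
    [g O <= g fset0 + k (M - g fset0)], which is at most [k M] since [k >= 1]. *)
Lemma best_singleton_ratio k n g O : (0 < k)%N ->
  nonnegative g -> monotone g -> submodular g ->
  O `<=` iota_fset n -> (#|` O| <= k)%N ->
  k%:R^-1 * g O <= g (best_singleton n g).
Proof.
move=> k0 g0 gm gs On Ok; set M := g (best_singleton n g).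
have M0 : g fset0 <= M by apply: gm; exact: fsub0set.
have kR : 0 < k%:R :> R by rewrite ltr0n.
have := @submodular_bound _ _ g gm gs fset0 O (M - g fset0).
have hO x : x \in O -> g (x |` fset0) - g fset0 <= M - g fset0.
  move=> /(fsubsetP On); rewrite in_iota_fset fsetU0 lerD2r.
  exact: best_singleton_max.
rewrite ler_pdivrMl // => /(_ hO) /le_trans; apply.
have : (M - g fset0) *+ #|` O| <= k%:R * (M - g fset0).
  by rewrite -[leLHS]mulr_natl ler_wpM2r ?subr_ge0 ?ler_nat.
have : g fset0 <= k%:R * g fset0 by rewrite ler_peMl ?ler1n.
by lra.
Qed.

End BestSingleton.

(** * Combination of the two algorithms *)

Theorem corollary3p1 (R : realType) :
  [/\ is_minimum [set guarantee R k | k in [set k : nat | (0 < k)%N]]%classic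
        (alpha R 4)^-1,
      2959%:R / 10%:R ^+ 4 < (alpha R 4)^-1 &
      forall k : nat, (0 < k)%N ->
        exists alg : online_algorithm R,
          feasible k alg /\ competitive k alg (alpha R 4)^-1].
Proof.
have [/andP[a3 a4] _] := @alphaP R 4 (leqnn 4).
split; first exact: guarantee_min.
  have := @alpha4_lt R => lt4.
  rewrite -[ltLHS]invrK ltf_pV2 ?posrE ?invr_gt0; lra.
move=> k k0; have [k3|k4] := leqP k 3.
  exists (selection_algorithm best_singleton); apply: selection_competitive => //.
  - exact: best_singletonS.
  - exact: best_singleton_local.
  - by move=> n g; exact: leq_trans (card_best_singleton n g) k0.
  move=> n g g0 gm gs O On Ok.
  apply: le_trans (best_singleton_ratio k0 g0 gm gs On Ok).
  rewrite ler_wpM2r // lef_pV2 ?posrE ?ltr0n //; last lra.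
  by have : k%:R <= 3 :> R; [rewrite (ler_nat _ k 3) | lra].
have [/andP[b3 b4] hb] := @alphaP R k k4.
pose q : R := 1 + (alpha R k - 2) / k.+1%:R.
have q1 : 1 < q by rewrite ltrDl divr_gt0 ?ltr0n //; lra.
have qE : alpha R k = 2 + k.+1%:R * (q - 1).
  rewrite (_ : q - 1 = (alpha R k - 2) / k.+1%:R); last by rewrite /q addrC addKr.
  by rewrite mulrC divfK ?pnatr_eq0 // addrC subrK.
exists (selection_algorithm (threshold_selection k (alpha R k))).
apply: selection_competitive => //.
- by move=> g; apply/fsetP => i; rewrite !inE.
- exact: threshold_selectionS.
- by move=> n g g' e; rewrite /threshold_selection (threshold_state_local _ _ e).
- by move=> n g; exact: card_threshold_selection.
move=> n g g0 gm gs O On Ok.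
apply: le_trans (threshold_selection_ratio k0 q1 (esym hb) qE g0 gm gs On Ok).
(* The ratio obtained is [1 / alpha_k]; [alpha_k <= alpha_4] makes it uniform in [k]. *)
by rewrite ler_wpM2r // lef_pV2 ?posrE ?alpha_le4 //; lra.
Qed.
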